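(* Fix a choice of sign and let $m=(-2\pm i)^k$ with $k\in\mathbb{N}$, $k\geq1$. Then there exists a Gaussian integer $a$ with $\gcd(a,m)=1$ and $a/m\in\mathfrak{F}$ such that $K_{\mathbb{C}}(a/m)\leq 3\sqrt{2}$.
   Context: $\mathfrak{F}=\{z\in\mathbb{C}: -\tfrac12\leq\mathrm{Re}(z)<\tfrac12,\ -\tfrac12\leq\mathrm{Im}(z)<\tfrac12\}$. For $z\in\mathbb{C}$, $[z]:=\lfloor \mathrm{Re}(z)+\tfrac12\rfloor+i\lfloor \mathrm{Im}(z)+\tfrac12\rfloor$. The complex Gauss map $T:\mathfrak{F}\to\mathfrak{F}$ is $T(z)=z^{-1}-[z^{-1}]$ for $z\neq0$, $T(0)=0$. For $z\in\mathfrak{F}\setminus\{0\}$, $a_1(z)=[z^{-1}]$ and, while $T^{n-1}(z)\neq0$, $a_n(z)=a_1(T^{n-1}(z))$; for $z\in\mathbb{Q}(i)\cap\mathfrak{F}$ this process terminates, giving the Hurwitz continued fraction $z=[a_1(z),\ldots,a_n(z)]_{\mathbb{C}}$. Define $K_{\mathbb{C}}(z)=\max(|a_1(z)|,\ldots,|a_n(z)|)$. *)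

(* Defs.v *)
From mathcomp Require Import all_boot all_order all_algebra.
From mathcomp Require Import boolp reals.
From mathcomp Require Export complex.
From mathcomp Require Import ring lra.

Set Implicit Arguments.
Unset Strict Implicit.
Unset Printing Implicit Defensive.

Import Order.TTheory GRing.Theory Num.Theory.

Local Open Scope ring_scope.
Local Open Scope complex_scope.

(* The usual complex numbers are R[i] for R : realType. The library's `|z| is
   valued in R[i]; this is the same modulus, valued in R. *)
Notation cabs := ComplexField.Normc.normc.

(* The R-valued projections, not those of numClosedFieldType. *)
Local Notation Re := complex.Re.
Local Notation Im := complex.Im.

Section Hurwitz.
Variable R : realType.
Implicit Types (z a b d g : R[i]) (n : nat).

Definition gauss_int z : bool := (Re z \is a Num.int) && (Im z \is a Num.int).

Definition gauss_dvd d z : Prop :=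
  exists2 q : R[i], gauss_int q & z = d * q.

(* g is a gcd of a and b in Z[i] (unique up to units). *)
Definition gauss_is_gcd a b g : Prop :=
  [/\ gauss_int g, gauss_dvd g a, gauss_dvd g b
    & forall d, gauss_int d -> gauss_dvd d a -> gauss_dvd d b -> gauss_dvd d g].

Definition fundamental_domain z : bool :=
  (- 2^-1 <= Re z < 2^-1) && (- 2^-1 <= Im z < 2^-1).

Definition gauss_round z : R[i] :=
  (Num.floor (Re z + 2^-1))%:~R +i* (Num.floor (Im z + 2^-1))%:~R.

Definition gauss_map z : R[i] :=
  if z == 0 then 0 else z^-1 - gauss_round z^-1.

(* a_n(z), indexed from n = 1; meaningful when T^(n-1)(z) != 0. *)
Definition hcf_digit n z : R[i] := gauss_round (iter n.-1 gauss_map z)^-1.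

(* The number of digits: the least n with T^n(z) = 0. The default 0 is never
   used on Q(i), by [gauss_map_terminates] below. *)
Definition hcf_length z : nat :=
  if pselect (exists n, iter n gauss_map z == 0) is left e then ex_minn e
  else 0%N.

Definition hcf_K z : R :=
  \big[Num.max/0]_(1 <= n < (hcf_length z).+1) cabs (hcf_digit n z).

Lemma gauss_map_domain z : fundamental_domain (gauss_map z).
Proof.
rewrite /gauss_map; case: eqP => _.
  by rewrite /fundamental_domain /=; apply/andP; split; apply/andP; split; lra.
move: (z^-1) => w; case: w => x y; rewrite /fundamental_domain /gauss_round /=.
have hx := Num.Theory.floor_itv (x + 2^-1).
have hy := Num.Theory.floor_itv (y + 2^-1).
move: hx hy; rewrite !intrD.
by move=> /andP[h1 h2] /andP[h3 h4]; apply/andP; split; apply/andP; split; lra.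
Qed.

Let nsq z : R := Re z ^+ 2 + Im z ^+ 2.

Lemma gauss_map_terminates a b : gauss_int a -> gauss_int b ->
  exists n, iter n gauss_map (a / b) == 0.
Proof.
have nsqM x y : nsq (x * y) = nsq x * nsq y.
  by case: x => x1 x2; case: y => y1 y2; rewrite /nsq /=; ring.
have giM x y : gauss_int x -> gauss_int y -> gauss_int (x * y).
  case: x => x1 x2; case: y => y1 y2 /andP[/= h1 h2] /andP[/= h3 h4].
  by apply/andP; split=> /=; rewrite ?rpredB ?rpredD ?rpredM.
have giB x y : gauss_int x -> gauss_int y -> gauss_int (x - y).
  case: x => x1 x2; case: y => y1 y2 /andP[/= h1 h2] /andP[/= h3 h4].
  by apply/andP; split=> /=; rewrite rpredB.
have gir x : gauss_int (gauss_round x) by rewrite /gauss_int /= !intr_int.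
have nat_nsq x : gauss_int x -> exists n : nat, nsq x = n%:R.
  case/andP=> h1 h2; apply/natrP; rewrite natrEint /nsq.
  by rewrite rpredD ?rpredX // addr_ge0 ?sqr_ge0.
have small z : nsq (gauss_map z) <= 2^-1.
  have /andP[/andP[h1 h2] /andP[h3 h4]] := gauss_map_domain z.
  by rewrite /nsq; nra.
have nsq0 x : nsq x = 0 -> x = 0.
  case: x => x y; rewrite /nsq /= => h.
  have x0 : x = 0 by nra.
  have y0 : y = 0 by nra.
  by rewrite x0 y0.
move=> ga gb; have [n en] := nat_nsq a ga.
elim/ltn_ind: n a b ga gb en => n IH a b ga gb en.
have [->|a0] := eqVneq a 0; first by exists 0%N; rewrite /= mul0r.
have [->|b0] := eqVneq b 0; first by exists 0%N; rewrite /= invr0 mulr0.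
have ab0 : a / b != 0 by rewrite mulf_neq0 ?invr_eq0.
pose r := b - a * gauss_round (a / b)^-1.
have gr : gauss_int r by apply: giB => //; apply: giM.
have eT : gauss_map (a / b) = r / a.
  by rewrite /gauss_map (negbTE ab0) /r mulrBl mulrAC divff // mul1r invf_div.
have [p ep] := nat_nsq r gr.
have er : r = a * gauss_map (a / b) by rewrite eT mulrC divfK.
have n0 : (0 : R) < n%:R.
  rewrite ltr0n lt0n; apply: contra_neq a0 => n0.
  by apply: nsq0; rewrite en n0.
have ltpn : (p < n)%N.
  rewrite -(ltr_nat R) -ep er nsqM en.
  have := small (a / b); nra.
have [q hq] := IH p ltpn r a gr ga ep.
by exists q.+1; rewrite iterSr eT.
Qed.

End Hurwitz.

(* Main.v *)
From HB Require Import structures.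
Require Import Defs.
From mathcomp Require Import all_boot all_order all_algebra reals.
From mathcomp Require Import boolp ring lra zify.

(** A word of Gaussian integers of norm at least 5, of two consecutive ones at
    least one having norm at least 9, is automatically a Hurwitz expansion:
    adding a point of the fundamental domain to a letter of norm at least 9
    leaves the modulus at least 5/2, so the inverse has modulus at most 2/5, and
    a letter of norm at least 5 tolerates a perturbation of that size.  It
    remains to find such words, with letters of norm at most 18, whose
    denominator is the given power up to a unit.  This is done by folding:
    writing [-w^r] for the negated reversal of [w],
    - [w, x, -w^r] has denominator [x q^2] up to sign, where [q] is that of [w];
    - if [x] is a unit, which is not an allowed digit, the middle of the folded
      word is contracted: the last letter [a] of [w] followed by [x] and [-a]
      becomes [a + u] followed by [u^2 (a - u)], with [u] a unit, and [-w^r]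
      becomes [u^2 w^r].
    With [x = -2 ± i] this passes from exponent [k] to [2k + 1], and with a
    unit from [k] to [2k].  Folding repeats the first letter of [w] at the end
    up to a unit, so only the extreme letters of the words for the exponents 3,
    4 and 5 must allow [a ± u] as digits.  The exponent 2 needs a separate
    word, which starts with the letter [1 ± i] of norm 2. *)

Set Implicit Arguments.
Unset Strict Implicit.
Unset Printing Implicit Defensive.

Import Order.TTheory GRing.Theory Num.Theory.
Import ComplexField.Normc.

Local Open Scope ring_scope.
Local Open Scope complex_scope.

Local Notation Re := complex.Re.
Local Notation Im := complex.Im.

Section Continuants.
Variable A : comNzRingType.
Implicit Types (a e u x : A) (s : seq A) (v : A * A).

(* [cf_act [:: a_1; ...; a_n]] is multiplication of the column (v.1, v.2) by
   the product of the matrices [[0, 1], [1, a_i]]. *)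
Definition cf_act s v : A * A :=
  foldr (fun a v => (v.2, a * v.2 + v.1)) v s.
Definition cf_num s : A := (cf_act s (0, 1)).1.
Definition cf_den s : A := (cf_act s (0, 1)).2.

Lemma cf_num_nil : cf_num [::] = 0.
Proof. by []. Qed.

Lemma cf_den_nil : cf_den [::] = 1.
Proof. by []. Qed.

Lemma cf_num_cons a s : cf_num (a :: s) = cf_den s.
Proof. by []. Qed.

Lemma cf_den_cons a s : cf_den (a :: s) = a * cf_den s + cf_num s.
Proof. by []. Qed.

Definition cf_simp := (cf_num_nil, cf_den_nil, cf_num_cons, cf_den_cons).

Lemma cf_act_cat s1 s2 v : cf_act (s1 ++ s2) v = cf_act s1 (cf_act s2 v).
Proof. exact: foldr_cat. Qed.

Lemma cf_act_snd s v :
  (cf_act s v).2 = cf_num (rev s) * v.1 + cf_den (rev s) * v.2.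
Proof.
elim/last_ind: s v => [|s a IHs] v; first by rewrite !cf_simp mul0r mul1r add0r.
by rewrite -cats1 cf_act_cat IHs cats1 rev_rcons !cf_simp /=; ring.
Qed.

Lemma cf_den_rev s : cf_den (rev s) = cf_den s.
Proof. by rewrite [RHS]cf_act_snd mulr0 add0r mulr1. Qed.

Lemma cf_den_cat s1 s2 : cf_den (s1 ++ s2) =
  cf_num (rev s1) * cf_num s2 + cf_den s1 * cf_den s2.
Proof. by rewrite -(cf_den_rev s1) -cf_act_snd -cf_act_cat. Qed.

Lemma cf_den_rcons s a : cf_den (rcons s a) = a * cf_den s + cf_num (rev s).
Proof. by rewrite -cf_den_rev rev_rcons cf_den_cons cf_den_rev. Qed.

Lemma cf_scale e s : e ^+ 2 = 1 ->
  cf_num (map ( *%R e) s) = e ^+ (size s).+1 * cf_num s /\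
  cf_den (map ( *%R e) s) = e ^+ size s * cf_den s.
Proof.
move=> e2; elim: s => [|a s [IHnum IHden]].
  by rewrite !cf_simp mulr0 expr0 mul1r.
rewrite /= !cf_simp IHnum IHden !exprS.
by split; ring: e2.
Qed.

Definition fold_word s x : seq A := s ++ x :: map ( *%R (-1)) (rev s).

Lemma fold_word_cons a s x :
  fold_word (a :: s) x = a :: rcons (fold_word s x) (-1 * a).
Proof. by rewrite /fold_word rev_cons map_rcons rcons_cat. Qed.

Lemma cf_den_fold_word s x :
  cf_den (fold_word s x) = (-1) ^+ size s * x * cf_den s ^+ 2.
Proof.
rewrite cf_den_cat !cf_simp.
have [|-> ->] := @cf_scale (-1) (rev s); first by rewrite sqrrN expr1n.
by rewrite size_rev cf_den_rev (exprS _ (size s)); ring.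
Qed.

Definition split_word s a u : seq A :=
  s ++ [:: a + u, u ^+ 2 * (a - u) & map ( *%R (u ^+ 2)) (rev s)].

Lemma split_word_cons b s a u :
  split_word (b :: s) a u = b :: rcons (split_word s a u) (u ^+ 2 * b).
Proof. by rewrite /split_word rev_cons map_rcons rcons_cat. Qed.

Lemma cf_den_split_word s a u : u ^+ 4 = 1 -> cf_den (split_word s a u) =
  (u ^+ 2) ^+ (size s).+1 * cf_den (rcons s a) ^+ 2.
Proof.
move=> u4; rewrite cf_den_cat cf_den_rcons !cf_simp.
have [|-> ->] := @cf_scale (u ^+ 2) (rev s); first by rewrite -exprM.
rewrite size_rev cf_den_rev (exprS _ (size s)).
by move: (cf_num _) (cf_den _) ((u ^+ 2) ^+ _) => p q e; ring: u4.
Qed.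

Variable S : subringClosed A.

Lemma rpred_cf s : all (mem S) s -> cf_num s \in S /\ cf_den s \in S.
Proof.
elim: s => [|a s IHs] /=; first by rewrite !cf_simp rpred0 rpred1.
by case/andP=> aS /IHs[numS denS]; rewrite !cf_simp rpredD ?rpredM.
Qed.

Lemma cf_bezout s : all (mem S) s ->
  exists c d, [/\ c \in S, d \in S & c * cf_num s + d * cf_den s = 1].
Proof.
elim: s => [_|a s IHs /= /andP[aS /IHs[c [d [cS dS cd1]]]]].
  by exists 0, 1; rewrite rpred0 rpred1 !cf_simp mulr0 add0r mulr1.
exists (d - a * c), c; rewrite rpredB ?rpredM // !cf_simp -cd1.
by split=> //; ring.
Qed.

End Continuants.

Section ContinuedFractionValue.
Variable F : fieldType.
Implicit Types (a : F) (s : seq F).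

Definition cf_val s : F := foldr (fun a w => (a + w)^-1) 0 s.

Lemma cf_val_num_den a s : cf_den s != 0 -> cf_val s = cf_num s / cf_den s ->
    a + cf_val s != 0 ->
  cf_den (a :: s) != 0 /\ cf_val (a :: s) = cf_num (a :: s) / cf_den (a :: s).
Proof.
move=> den0 val_s tail0.
have -> : cf_den (a :: s) = cf_den s * (a + cf_val s).
  by rewrite cf_den_cons val_s mulrDr mulrC mulrCA divff // mulr1.
by rewrite mulf_neq0 // cf_num_cons invfM mulVKf.
Qed.

End ContinuedFractionValue.

Section GaussianIntegers.
Variable R : realType.
Implicit Types (a b c d u w z : R[i]).

Lemma gauss_int_subring_closed : subring_closed (@gauss_int R).
Proof.
split=> [|[p q] [r s] /andP[/= pZ qZ] /andP[/= rZ sZ]|].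
- by rewrite unfold_in /gauss_int rpred1 rpred0.
- by rewrite unfold_in /gauss_int /= !rpredB.
move=> [p q] [r s] /andP[/= pZ qZ] /andP[/= rZ sZ].
by rewrite unfold_in /gauss_int /= ?(rpredB, rpredD, rpredM).
Qed.

HB.instance Definition _ :=
  GRing.isSubringClosed.Build R[i] (@gauss_int R) gauss_int_subring_closed.

Lemma gauss_intE z : gauss_int z = (z \in @gauss_int R).
Proof. by []. Qed.

Lemma sqr_cabs z : cabs z ^+ 2 = Re z ^+ 2 + Im z ^+ 2.
Proof. by case: z => p q; rewrite sqr_sqrtr // addr_ge0 ?sqr_ge0. Qed.

Lemma cabs_ge0 z : 0 <= cabs z.
Proof. by case: z => p q; exact: sqrtr_ge0. Qed.

Lemma sqr_cabs_int z : gauss_int z -> cabs z ^+ 2 \is a Num.int.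
Proof. by case/andP=> ? ?; rewrite sqr_cabs rpredD ?rpredX. Qed.

Lemma cabs_sub_le z w : cabs z - cabs w <= cabs (z + w).
Proof. by rewrite lerBlDr -{1}[z](addrK w) -(normcN w) le_normcD. Qed.

Lemma cabs_gt0_neq0 z : 0 < cabs z -> z != 0.
Proof. by apply: contraTneq => ->; rewrite normc0 ltxx. Qed.

(* The units of Z[i] are the fourth roots of unity. *)
Definition gauss_unit u : Prop := u ^+ 4 = 1.

Lemma gauss_unit1 : gauss_unit 1.
Proof. exact: expr1n. Qed.

Lemma gauss_unitN1 : gauss_unit (-1).
Proof. by rewrite /gauss_unit -signr_odd expr0. Qed.

Lemma gauss_unit_i : gauss_unit 'i.
Proof. by rewrite /gauss_unit (exprM _ 2 2) sqr_i sqrrN expr1n. Qed.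

Lemma gauss_unitM u w : gauss_unit u -> gauss_unit w -> gauss_unit (u * w).
Proof. by rewrite /gauss_unit exprMn => -> ->; rewrite mulr1. Qed.

Lemma gauss_unitX u n : gauss_unit u -> gauss_unit (u ^+ n).
Proof. by rewrite /gauss_unit exprAC => ->; rewrite expr1n. Qed.

Lemma gauss_unitV u : gauss_unit u -> gauss_unit u^-1.
Proof. by rewrite /gauss_unit exprVn => ->; rewrite invr1. Qed.

Lemma gauss_unit_neq0 u : gauss_unit u -> u != 0.
Proof. by apply: contra_eqN => /eqP->; rewrite expr0n eq_sym oner_eq0. Qed.

Lemma gauss_unitP u : gauss_unit u -> [\/ u = 1, u = -1, u = 'i | u = - 'i].
Proof.
move/eqP; rewrite (exprM _ 2 2) sqrf_eq1.
case/orP; [rewrite sqrf_eq1|rewrite -sqr_i eqf_sqr] => /orP[]/eqP->.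
- by constructor 1.
- by constructor 2.
- by constructor 3.
- by constructor 4.
Qed.

Lemma gauss_int_unit u : gauss_unit u -> gauss_int u.
Proof.
have iZ : 'i \in @gauss_int R by rewrite unfold_in /gauss_int rpred0 rpred1.
by case/gauss_unitP=> ->; rewrite gauss_intE ?rpredN ?rpred1.
Qed.

Lemma cabs_unit u : gauss_unit u -> cabs u = 1.
Proof.
by case/gauss_unitP=> ->;
  rewrite ?normcN ?normc1 //= expr0n expr1n add0r sqrtr1.
Qed.

Lemma gauss_is_gcd_bezout a b c d :
    gauss_int a -> gauss_int b -> gauss_int c -> gauss_int d ->
  c * a + d * b = 1 -> gauss_is_gcd a b 1.
Proof.
move=> aZ bZ cZ dZ bezout; split; first by rewrite gauss_intE rpred1.
- by exists a; rewrite ?mul1r.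
- by exists b; rewrite ?mul1r.
move=> g _ [q qZ aE] [r rZ bE]; exists (c * q + d * r).
  by rewrite gauss_intE rpredD ?rpredM.
by rewrite -bezout aE bE; ring.
Qed.

Lemma gauss_round_add a w :
  gauss_int a -> fundamental_domain w -> gauss_round (a + w) = a.
Proof.
case: a w => [p q] [r s] /andP[/= /intrP[m ->] /intrP[n ->]].
move=> /andP[/= /andP[r_ge r_lt] /andP[s_ge s_lt]]; rewrite /gauss_round /=.
rewrite (@floor_def _ _ m) ?(@floor_def _ _ n) //.
  by rewrite intrD; apply/andP; split; lra.
by rewrite intrD; apply/andP; split; lra.
Qed.

End GaussianIntegers.

Section HurwitzWords.
Variable R : realType.
Implicit Types (a b m u w z : R[i]) (s : seq R[i]) (K : R).

Fixpoint hurwitz_word s : bool :=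
  fundamental_domain (cf_val s) &&
  (if s is a :: s' then
     [&& gauss_int a, a + cf_val s' != 0 & hurwitz_word s']
   else true).

Lemma hurwitz_word_cons a s : hurwitz_word (a :: s) =
  [&& fundamental_domain (a + cf_val s)^-1, gauss_int a, a + cf_val s != 0
    & hurwitz_word s].
Proof. by []. Qed.

Lemma hurwitz_word_domain s : hurwitz_word s -> fundamental_domain (cf_val s).
Proof. by case: s => [|a s] /andP[]. Qed.

Lemma hurwitz_word_drop n s : hurwitz_word s -> hurwitz_word (drop n s).
Proof. by elim: n s => [|n IHn] [|a s] // /and4P[_ _ _ /IHn]. Qed.

Lemma hurwitz_word_gauss_int s : hurwitz_word s -> all (mem (@gauss_int R)) s.
Proof. by elim: s => //= a s IHs /and4P[_ aZ _ /IHs->]; rewrite andbT. Qed.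

Lemma gauss_round_inv_cf_val a s : hurwitz_word (a :: s) ->
  gauss_round (cf_val (a :: s))^-1 = a.
Proof.
by case/and4P=> _ aZ _ /hurwitz_word_domain ?; rewrite /= invrK gauss_round_add.
Qed.

Lemma gauss_map_cf_val s : hurwitz_word s ->
  gauss_map (cf_val s) = cf_val (behead s).
Proof.
case: s => [_|a s as_word]; first by rewrite /gauss_map eqxx.
rewrite /gauss_map gauss_round_inv_cf_val //=.
case/and4P: as_word => _ _ tail0 _.
by rewrite invr_eq0 (negbTE tail0) invrK addrC addKr.
Qed.

Lemma iter_gauss_map_cf_val n s : hurwitz_word s ->
  iter n (@gauss_map R) (cf_val s) = cf_val (drop n s).
Proof.
move=> s_word; elim: n => [|n IHn]; first by rewrite drop0.
by rewrite iterS IHn gauss_map_cf_val ?hurwitz_word_drop // -drop1 drop_drop.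
Qed.

Lemma cf_val_eq0 s : hurwitz_word s -> (cf_val s == 0) = nilp s.
Proof.
case: s => [|a s]; first by rewrite eqxx.
by case/and4P=> _ _ tail0 _; rewrite invr_eq0 (negbTE tail0).
Qed.

Lemma hcf_length_cf_val s : hurwitz_word s -> hcf_length (cf_val s) = size s.
Proof.
move=> s_word.
have iter_eq0 n : (iter n (@gauss_map R) (cf_val s) == 0) = (size s <= n)%N.
  rewrite iter_gauss_map_cf_val // cf_val_eq0 ?hurwitz_word_drop //.
  by rewrite /nilp size_drop.
rewrite /hcf_length; case: pselect => [e|[]]; last first.
  by exists (size s); rewrite iter_eq0.
case: ex_minnP => n; rewrite iter_eq0 => size_le n_min.
by apply/eqP; rewrite eqn_leq size_le n_min ?iter_eq0.
Qed.

Lemma hcf_digit_cf_val n s : hurwitz_word s -> (n < size s)%N ->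
  hcf_digit n.+1 (cf_val s) = nth 0 s n.
Proof.
move=> s_word /(drop_nth 0) drop_s.
rewrite /hcf_digit iter_gauss_map_cf_val //=.
by rewrite drop_s gauss_round_inv_cf_val // -drop_s hurwitz_word_drop.
Qed.

Lemma hcf_K_cf_val s : hurwitz_word s ->
  hcf_K (cf_val s) = \big[Num.max/0]_(a <- s) cabs a.
Proof.
move=> s_word; rewrite /hcf_K hcf_length_cf_val // big_add1 [RHS](big_nth 0).
by apply: eq_big_nat => n /andP[_ n_lt]; rewrite hcf_digit_cf_val.
Qed.

Lemma hurwitz_word_num_den s : hurwitz_word s ->
  cf_den s != 0 /\ cf_val s = cf_num s / cf_den s.
Proof.
elim: s => [_|a s IHs /and4P[_ _ tail0 /IHs[den0 val_s]]].
  by rewrite !cf_simp oner_eq0 mul0r.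
exact: cf_val_num_den.
Qed.

Definition hcf_bounded_denominator K m : Prop := exists a,
  [/\ gauss_int a, gauss_is_gcd a m 1, fundamental_domain (a / m)
    & hcf_K (a / m) <= K].

Lemma hurwitz_word_bounded_denominator K s u m : 0 <= K -> hurwitz_word s ->
    all (fun a => cabs a ^+ 2 <= K ^+ 2) s -> gauss_unit u ->
    cf_den s = u * m ->
  hcf_bounded_denominator K m.
Proof.
move=> K_ge0 s_word s_le u_unit den_s.
have sZ := hurwitz_word_gauss_int s_word.
have [numZ denZ] := rpred_cf sZ.
have [c [d [cZ dZ bezout]]] := cf_bezout sZ.
have [_ val_s] := hurwitz_word_num_den s_word.
have u0 := gauss_unit_neq0 u_unit.
have uZ : u \in @gauss_int R by exact: gauss_int_unit.
have uVZ : u^-1 \in @gauss_int R by exact/gauss_int_unit/gauss_unitV.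
have m_den : m = u^-1 * cf_den s by rewrite den_s mulKf.
exists (u^-1 * cf_num s).
have -> : u^-1 * cf_num s / m = cf_val s.
  by rewrite val_s den_s invfM mulrA; congr (_ * _); rewrite mulrC.
split.
- by rewrite gauss_intE rpredM.
- apply: (@gauss_is_gcd_bezout _ _ _ (u * c) (u * d));
    rewrite ?m_den ?gauss_intE ?rpredM //.
  by rewrite -bezout; field.
- exact: hurwitz_word_domain.
- rewrite hcf_K_cf_val // big_seq.
  apply: bigmax_le => // a /(allP s_le).
  by rewrite ler_sqr ?nnegrE ?cabs_ge0.
Qed.

End HurwitzWords.

Section FundamentalDomain.
Variable R : realType.
Implicit Types (a u w z : R[i]).

Lemma Re_le_cabs z : `|Re z| <= cabs z.
Proof. by case: z => x y; rewrite -sqrtr_sqr ler_wsqrtr // lerDl sqr_ge0. Qed.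

Lemma Im_le_cabs z : `|Im z| <= cabs z.
Proof. by case: z => x y; rewrite -sqrtr_sqr ler_wsqrtr // lerDr sqr_ge0. Qed.

Lemma fundamental_domain_small z : cabs z < 2^-1 -> fundamental_domain z.
Proof.
move=> z_lt; have [re_le im_le] := (Re_le_cabs z, Im_le_cabs z).
have /andP[? ?] : - 2^-1 < Re z < 2^-1.
  by rewrite -ltr_norml (le_lt_trans re_le).
have /andP[? ?] : - 2^-1 < Im z < 2^-1.
  by rewrite -ltr_norml (le_lt_trans im_le).
by rewrite /fundamental_domain !ltW //=; apply/andP.
Qed.

(* Inversion exchanges the lines [Re z = ± 1/2] and [Im z = ± 1/2] with the
   unit circles centered at the units. *)
Lemma fundamental_domain_inv z :
  (forall u, gauss_unit u -> 1 < cabs (z - u)) -> fundamental_domain z^-1.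
Proof.
case: z => x y outside; rewrite /fundamental_domain /=.
have outside_sqr u : gauss_unit u -> 1 < (x - Re u) ^+ 2 + (y - Im u) ^+ 2.
  move=> u_unit; have := exprn_egt1 2 (outside u u_unit).
  by rewrite sqr_cabs; case: u {u_unit} => p q; exact.
have /= right := outside_sqr _ (gauss_unit1 R).
have /= left := outside_sqr _ (gauss_unitN1 R).
have /= above := outside_sqr _ (gauss_unit_i R).
have /= below := outside_sqr _ (gauss_unitM (gauss_unitN1 R) (gauss_unit_i R)).
set d := x ^+ 2 + y ^+ 2.
have xd : - d < 2 * x < d by rewrite /d; apply/andP; split; lra.
have yd : - d < 2 * y < d by rewrite /d; apply/andP; split; lra.
have div_half (r : R) : - d < 2 * r < d -> - 2^-1 < r / d < 2^-1.
  case/andP=> r_gt r_lt; have d_gt0 : 0 < d by lra.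
  by rewrite ltr_pdivlMr // ltr_pdivrMr //; apply/andP; split; lra.
have [/andP[? ?] /andP[? ?]] := (div_half x xd, div_half y yd).
by apply/andP; split; apply/andP; split; lra.
Qed.

Lemma gauss_int_large_coord a : gauss_int a -> 9 <= cabs a ^+ 2 ->
  (3 <= `|Re a|) || (3 <= `|Im a|).
Proof.
rewrite sqr_cabs; case: a => p q /andP[/= /intrP[m ->] /intrP[n ->]].
rewrite -!intr_norm -!rmorphXn -rmorphD /=.
rewrite (ler_int R 9) !(ler_int R 3); apply: contraLR.
have sqr_le4 (k : int) : `|k| < 3 -> k ^+ 2 <= 4 by nia.
by rewrite negb_or -!ltNge => /andP[/sqr_le4 m_le /sqr_le4 n_le]; lia.
Qed.

Lemma cabs_add_large a w : gauss_int a -> 9 <= cabs a ^+ 2 ->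
  fundamental_domain w -> 5 / 2 <= cabs (a + w).
Proof.
move=> aZ a_large /andP[/andP[re_ge re_lt] /andP[im_ge im_lt]].
have half_norm (r : R) : - 2^-1 <= r -> r < 2^-1 -> `|r| <= 2^-1.
  by move=> ? ?; rewrite ler_norml; apply/andP; split; lra.
have re_w := half_norm _ re_ge re_lt; have im_w := half_norm _ im_ge im_lt.
case/orP: (gauss_int_large_coord aZ a_large) => a_ge.
- apply: le_trans (Re_le_cabs _); have := lerB_normD (Re a) (Re w).
  have -> : Re (a + w) = Re a + Re w by case: (a) (w) => [p q] [].
  by lra.
- apply: le_trans (Im_le_cabs _); have := lerB_normD (Im a) (Im w).
  have -> : Im (a + w) = Im a + Im w by case: (a) (w) => [p q] [].
  by lra.
Qed.

Lemma cabs_inv_add_large a w : gauss_int a -> 9 <= cabs a ^+ 2 ->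
  fundamental_domain w -> a + w != 0 /\ cabs (a + w)^-1 <= 2 / 5.
Proof.
move=> aZ a_large w_dom; have aw_ge := cabs_add_large aZ a_large w_dom.
have aw_gt0 : 0 < cabs (a + w) by lra.
split; first exact: cabs_gt0_neq0.
by rewrite normcV -[leRHS]invf_div lef_pV2 ?posrE //; lra.
Qed.

(* [|a - u| >= sqrt 5 - 1 > 1], and the squared modulus is an integer. *)
Lemma sqr_cabs_sub_unit_ge2 a u : gauss_int a -> 5 <= cabs a ^+ 2 ->
  gauss_unit u -> 2 <= cabs (a - u) ^+ 2.
Proof.
move=> aZ a_ge5 u_unit; have uZ := gauss_int_unit u_unit.
have a_gt2 : 2 < cabs a by have := cabs_ge0 a; nra.
have au_gt1 : 1 < cabs (a - u).
  by have := cabs_sub_le a (- u); rewrite normcN (cabs_unit u_unit); lra.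
have : 1 < cabs (a - u) ^+ 2 by rewrite exprn_egt1.
have /intrP[n ->] : cabs (a - u) ^+ 2 \is a Num.int.
  by rewrite sqr_cabs_int // gauss_intE rpredB.
by rewrite (ltr_int R 1) (ler_int R 2).
Qed.

Lemma inv_add_small a w : gauss_int a -> 5 <= cabs a ^+ 2 -> cabs w <= 2 / 5 ->
  a + w != 0 /\ fundamental_domain (a + w)^-1.
Proof.
move=> aZ a_ge5 w_le; split.
  apply: cabs_gt0_neq0.
  by have := cabs_sub_le a w; have := cabs_ge0 a; nra.
apply: fundamental_domain_inv => u u_unit.
have au_gt : 7 / 5 < cabs (a - u).
  have := sqr_cabs_sub_unit_ge2 aZ a_ge5 u_unit.
  by have := cabs_ge0 (a - u); nra.
by have := cabs_sub_le (a - u) w; rewrite addrAC; lra.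
Qed.

End FundamentalDomain.

Lemma sorted_cat_cons_rel (T : Type) (r : rel T) x s1 s2 :
  (forall y, r x y) -> (forall y, r y x) ->
  sorted r (s1 ++ x :: s2) = sorted r s1 && sorted r s2.
Proof.
move=> rx_ r_x; have path_x : path r x s2 = sorted r s2.
  by case: s2 => //= y s2; rewrite rx_.
by case: s1 => [|y s1] //=; rewrite cat_path /= r_x path_x.
Qed.

Section RobustWords.
Variables (R : realType) (K : R).
Implicit Types (a b m u x : R[i]) (s : seq R[i]).

Definition large a : bool := 9 <= cabs a ^+ 2.

Definition digit a : bool := gauss_int a && (5 <= cabs a ^+ 2 <= K ^+ 2).

Definition large_digit a : bool := digit a && large a.

Definition robust_word s : bool :=
  all digit s && sorted (fun a b => large a || large b) s.

Lemma large_scale u a : gauss_unit u -> large (u * a) = large a.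
Proof. by move=> u_unit; rewrite /large normcM cabs_unit ?mul1r. Qed.

Lemma digit_scale u a : gauss_unit u -> digit (u * a) = digit a.
Proof.
move=> u_unit; rewrite /digit normcM cabs_unit // mul1r.
have uZ := gauss_int_unit u_unit.
have uVZ := gauss_int_unit (gauss_unitV u_unit).
congr (_ && _); apply/idP/idP => aZ; last by rewrite gauss_intE rpredM.
by rewrite -(mulKf (gauss_unit_neq0 u_unit) a) gauss_intE rpredM.
Qed.

Lemma robust_word_rev s : robust_word (rev s) = robust_word s.
Proof.
rewrite /robust_word all_rev rev_sorted; congr (_ && _).
by apply: eq_sorted => a b; rewrite orbC.
Qed.

Lemma robust_word_scale u s : gauss_unit u ->
  robust_word (map ( *%R u) s) = robust_word s.
Proof.
move=> u_unit; rewrite /robust_word all_map sorted_map; congr (_ && _).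
  by apply: eq_all => a /=; rewrite digit_scale.
by apply: eq_sorted => a b /=; rewrite !large_scale.
Qed.

Lemma robust_word_cat_large s1 b s2 : large b ->
  robust_word (s1 ++ b :: s2) = [&& robust_word s1, digit b & robust_word s2].
Proof.
move=> b_large; rewrite /robust_word all_cat /= sorted_cat_cons_rel => [|a|a].
- by rewrite -!andbA; do !bool_congr.
- by rewrite b_large.
- by rewrite b_large orbT.
Qed.

Lemma robust_word_enclosed a s b : large_digit a -> large_digit b ->
  robust_word s -> robust_word (a :: rcons s b).
Proof.
move=> /andP[a_digit a_large] /andP[b_digit b_large] s_robust.
rewrite -cats1 -[a :: _]/([::] ++ _) !robust_word_cat_large //.
by rewrite a_digit b_digit s_robust.
Qed.

Lemma robust_word_fold_word s b x : large_digit b -> digit x -> robust_word s ->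
  robust_word (fold_word (rcons s b) x).
Proof.
move=> /andP[b_digit b_large] x_digit s_robust; have N1_unit := gauss_unitN1 R.
rewrite /fold_word cat_rcons rev_rcons robust_word_cat_large //.
rewrite s_robust b_digit /= -[x :: _]/([:: x] ++ _).
rewrite robust_word_cat_large ?large_scale // digit_scale // b_digit.
rewrite robust_word_scale // robust_word_rev s_robust.
by rewrite /robust_word /= x_digit.
Qed.

Lemma robust_word_split_word s b u : gauss_unit u ->
    large_digit (b + u) -> large_digit (b - u) -> robust_word s ->
  robust_word (split_word s b u).
Proof.
move=> u_unit /andP[bDu_digit bDu_large] /andP[bBu_digit bBu_large] s_robust.
have u2_unit : gauss_unit (u ^+ 2) by exact: gauss_unitX.
rewrite /split_word robust_word_cat_large // s_robust bDu_digit /=.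
rewrite -[_ :: _]/([::] ++ _) robust_word_cat_large ?large_scale //.
by rewrite digit_scale // bBu_digit robust_word_scale // robust_word_rev.
Qed.

Lemma hurwitz_word_large_cons b s : large b -> hurwitz_word (b :: s) ->
  cabs (cf_val (b :: s)) <= 2 / 5.
Proof.
move=> b_large /and4P[_ bZ _ /hurwitz_word_domain s_dom].
by have [] := cabs_inv_add_large bZ b_large s_dom.
Qed.

Lemma robust_word_hurwitz s : robust_word s -> hurwitz_word s.
Proof.
elim: s => [_|a s IHs].
  by rewrite /= andbT fundamental_domain_small // normc0 invr_gt0.
rewrite hurwitz_word_cons => /andP[].
move=> /andP[/andP[aZ /andP[a_ge5 _]] s_digits] as_large.
have s_word : hurwitz_word s.
  by apply/IHs/andP; split=> //; exact: path_sorted as_large.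
rewrite aZ s_word andbT /=.
have [a_large|a_small] := boolP (large a).
  have s_dom := hurwitz_word_domain s_word.
  have [aw0 inv_le] := cabs_inv_add_large aZ a_large s_dom.
  by rewrite aw0 andbT fundamental_domain_small //; lra.
have [|aw0 aw_dom] := @inv_add_small _ a (cf_val s) aZ a_ge5; last exact/andP.
case: s as_large s_word {IHs s_digits} => [_ _|b s].
- by rewrite normc0; lra.
- rewrite /= (negbTE a_small) => /andP[b_large _].
  exact: hurwitz_word_large_cons.
Qed.

Lemma large_digit_scale u a :
  gauss_unit u -> large_digit (u * a) = large_digit a.
Proof. by move=> u_unit; rewrite /large_digit digit_scale ?large_scale. Qed.

Definition splittable a : Prop := large_digit a /\
  exists u, [/\ gauss_unit u, large_digit (a + u) & large_digit (a - u)].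

Lemma splittable_scale e a : gauss_unit e -> splittable a -> splittable (e * a).
Proof.
move=> e_unit [a_large [u [u_unit add_large sub_large]]].
split; first by rewrite large_digit_scale.
exists (e * u); split; first exact: gauss_unitM.
- by rewrite -mulrDr large_digit_scale.
- by rewrite -mulrBr large_digit_scale.
Qed.

Lemma splittable1 a : large_digit a -> large_digit (a + 1) ->
  large_digit (a - 1) -> splittable a.
Proof. by move=> *; split=> //; exists 1; split=> //; exact: gauss_unit1. Qed.

Lemma splittable_i a : large_digit a -> large_digit (a + 'i) ->
  large_digit (a - 'i) -> splittable a.
Proof. by move=> *; split=> //; exists 'i; split=> //; exact: gauss_unit_i. Qed.

Definition foldable m : Prop := exists a s b u,
  [/\ splittable a, splittable b, robust_word s, gauss_unit u
    & cf_den (a :: rcons s b) = u * m].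

Lemma foldable_mul_sqr x m : digit x -> foldable m -> foldable (x * m ^+ 2).
Proof.
move=> x_digit [a [s [b [u [a_split b_split s_robust u_unit den_word]]]]].
exists a, (fold_word (rcons s b) x), (-1 * a).
exists ((-1) ^+ size (a :: rcons s b) * u ^+ 2); split=> //.
- exact/splittable_scale/a_split/gauss_unitN1.
- by apply: robust_word_fold_word => //; case: b_split.
- by apply: gauss_unitM; apply: gauss_unitX => //; exact: gauss_unitN1.
- by rewrite -fold_word_cons cf_den_fold_word den_word; ring.
Qed.

Lemma foldable_sqr m : foldable m -> foldable (m ^+ 2).
Proof.
move=> [a [s [b [v [a_split b_split s_robust v_unit den_word]]]]].
have [_ [u [u_unit bDu_large bBu_large]]] := b_split.
have u2_unit : gauss_unit (u ^+ 2) by exact: gauss_unitX.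
exists a, (split_word s b u), (u ^+ 2 * a).
exists ((u ^+ 2) ^+ (size (a :: s)).+1 * v ^+ 2); split=> //.
- exact: splittable_scale.
- exact: robust_word_split_word.
- by apply: gauss_unitM; exact: gauss_unitX.
- by rewrite -split_word_cons cf_den_split_word // rcons_cons den_word; ring.
Qed.

Hypothesis K_ge0 : 0 <= K.

Lemma robust_word_bounded_denominator s u m :
    robust_word s -> gauss_unit u -> cf_den s = u * m ->
  hcf_bounded_denominator K m.
Proof.
move=> s_robust u_unit den_s.
apply: hurwitz_word_bounded_denominator u_unit den_s => //.
  exact: robust_word_hurwitz.
by case/andP: s_robust => s_digits _; apply: sub_all s_digits => a /and3P[].
Qed.

Lemma foldable_bounded_denominator m :
  foldable m -> hcf_bounded_denominator K m.
Proof.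
move=> [a [s [b [u [[a_large _] [b_large _] s_robust u_unit den_word]]]]].
apply: robust_word_bounded_denominator u_unit den_word.
exact: robust_word_enclosed.
Qed.

End RobustWords.

Section PowersOfNorm5.
Variables (R : realType) (K e : R).
Implicit Types z : R[i].
Hypotheses (sqr_K_ge18 : 18 <= K ^+ 2) (sqr_e : e ^+ 2 = 1).

Let e_int : e \is a Num.int.
Proof.
by move/eqP: sqr_e; rewrite sqrf_eq1 => /orP[]/eqP->; rewrite ?rpredN rpred1.
Qed.

Let e_itv : -1 <= e <= 1.
Proof.
by move/eqP: sqr_e; rewrite sqr_norm_eq1 -ler_norml => /eqP->.
Qed.

Let base : R[i] := -2 +i* e.

Lemma digit_coord z :
  gauss_int z -> 5 <= Re z ^+ 2 + Im z ^+ 2 <= 18 -> digit K z.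
Proof.
by rewrite /digit sqr_cabs => -> /andP[-> /le_trans]; apply.
Qed.

Lemma large_digit_coord z :
  gauss_int z -> 9 <= Re z ^+ 2 + Im z ^+ 2 <= 18 -> large_digit K z.
Proof.
move=> zZ /andP[ge9 le18]; rewrite /large_digit /large sqr_cabs ge9 andbT.
by apply: digit_coord => //; apply/andP; split; lra.
Qed.

Local Ltac gauss_int_coord :=
  by rewrite /gauss_int /=
     ?(e_int, rpredN, rpredB, rpredD, rpredM, rpred_nat, rpred0, rpred1).

Local Ltac norm_bounds :=
  have [? /andP[? ?]] := (sqr_e, e_itv); rewrite /=; apply/andP; split; lra.

Local Ltac solve_digit := apply: digit_coord; [gauss_int_coord|norm_bounds].

Local Ltac solve_large_digit :=
  apply: large_digit_coord; [gauss_int_coord|norm_bounds].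

Local Ltac solve_complex_eq :=
  apply/eqP; rewrite eq_complex; apply/andP; split; apply/eqP; rewrite /=;
  ring: sqr_e.

Lemma digit_base : digit K base.
Proof. by solve_digit. Qed.

Lemma foldable_exp3 : foldable K (base ^+ 3).
Proof.
exists (3 +i* (2 * e)), [::], (1 +i* (3 * e)), 1; split=> //.
- by apply: splittable_i; solve_large_digit.
- by apply: splittable1; solve_large_digit.
- exact: gauss_unit1.
- by rewrite !cf_simp; solve_complex_eq.
Qed.

Lemma foldable_exp4 : foldable K (base ^+ 4).
Proof.
exists 3, [:: 1 +i* (-2 * e)], (2 +i* (-3 * e)), 1; split.
- by apply: splittable_i; solve_large_digit.
- by apply: splittable1; solve_large_digit.
- by rewrite /robust_word /= !andbT; solve_digit.
- exact: gauss_unit1.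
- by rewrite !cf_simp; solve_complex_eq.
Qed.

Lemma foldable_exp5 : foldable K (base ^+ 5).
Proof.
exists 4, [:: (-1) +i* (4 * e)], (-2 +i* (3 * e)), (-1); split.
- by apply: splittable_i; solve_large_digit.
- by apply: splittable1; solve_large_digit.
- by rewrite /robust_word /= !andbT; solve_digit.
- exact: gauss_unitN1.
- by rewrite !cf_simp; solve_complex_eq.
Qed.

Lemma foldable_exp k : (3 <= k)%N -> foldable K (base ^+ k).
Proof.
elim/ltn_ind: k => k IHk k_ge3.
have [->|k_neq3] := eqVneq k 3; first exact: foldable_exp3.
have [->|k_neq4] := eqVneq k 4; first exact: foldable_exp4.
have [->|k_neq5] := eqVneq k 5; first exact: foldable_exp5.
have half_foldable : foldable K (base ^+ k./2) by apply: IHk; lia.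
rewrite -(odd_double_half k) -muln2 exprD exprM; case: (odd k).
- by rewrite expr1; exact: foldable_mul_sqr digit_base half_foldable.
- by rewrite expr0 mul1r; exact: foldable_sqr.
Qed.

Hypothesis K_ge0 : 0 <= K.

Lemma hcf_bounded_denominator_exp1 : hcf_bounded_denominator K base.
Proof.
have base_robust : robust_word K [:: base].
  by rewrite /robust_word /= digit_base.
apply: (robust_word_bounded_denominator K_ge0 base_robust (gauss_unit1 R)).
by rewrite !cf_simp mulr1 addr0 mul1r.
Qed.

Lemma hurwitz_word_exp2 : hurwitz_word [:: 1 +i* e; 3].
Proof.
have three_word : hurwitz_word [:: 3 : R[i]].
  apply: (@robust_word_hurwitz _ 3); rewrite /robust_word /=.
  rewrite !andbT /digit sqr_cabs.
  by apply/and3P; split; [gauss_int_coord|rewrite /=; lra|rewrite /=; lra].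
have tail : (1 +i* e) + cf_val [:: 3] = (4 / 3) +i* e.
  rewrite /= addr0; apply/eqP; rewrite eq_complex.
  by apply/andP; split; apply/eqP; rewrite /=; field.
rewrite hurwitz_word_cons tail three_word andbT; apply/and3P; split.
- apply: fundamental_domain_inv => u u_unit.
  rewrite -(@ltr_pXn2r _ 2) ?nnegrE ?cabs_ge0 // expr1n sqr_cabs.
  have [? /andP[? ?]] := (sqr_e, e_itv).
  by case/gauss_unitP: u_unit => -> /=; lra.
- by gauss_int_coord.
- by rewrite eq_complex /=; apply/nandP; left; apply/eqP; lra.
Qed.

Lemma hcf_bounded_denominator_exp2 : hcf_bounded_denominator K (base ^+ 2).
Proof.
have ie_unit : gauss_unit (0 +i* e) by rewrite /gauss_unit; solve_complex_eq.
apply: (hurwitz_word_bounded_denominator K_ge0 hurwitz_word_exp2 _ ie_unit).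
- have ? := sqr_e; apply/and3P; split=> //; apply: le_trans sqr_K_ge18.
    by rewrite sqr_cabs /=; lra.
  by rewrite sqr_cabs /=; lra.
- by rewrite !cf_simp; solve_complex_eq.
Qed.

Lemma hcf_bounded_denominator_exp k :
  (0 < k)%N -> hcf_bounded_denominator K (base ^+ k).
Proof.
case: k => [//|[_|[_|k _]]].
- exact: hcf_bounded_denominator_exp1.
- exact: hcf_bounded_denominator_exp2.
- by apply: foldable_bounded_denominator => //; exact: foldable_exp.
Qed.

End PowersOfNorm5.

Theorem theorem5p2 (R : realType) (plus : bool) (k : nat) (hk : (1 <= k)%N)
    (m : R[i]) (hm : m = (if plus then - 2 + 'i%C else - 2 - 'i%C) ^+ k) :
  exists a : R[i],
    [/\ gauss_int a,
        gauss_is_gcd a m 1,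
        fundamental_domain (a / m)
      & hcf_K (a / m) <= 3 * Num.sqrt 2].
Proof.
pose e : R := (-1) ^+ ~~ plus.
have -> : m = (-2 +i* e) ^+ k.
  rewrite hm /e; congr (_ ^+ _); apply/eqP; rewrite eq_complex.
  by case: plus {hm e}; apply/andP; split; apply/eqP; rewrite /=; ring.
apply: (@hcf_bounded_denominator_exp _ (3 * Num.sqrt 2) e) => //.
- by rewrite exprMn sqr_sqrtr //; lra.
- exact: sqrr_sign.
- by rewrite mulr_ge0 ?sqrtr_ge0.
Qed.
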